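(* Let $n\ge 1$ and let $K_n$ be the $n$-dimensional Klein bottle. Then $K_n$ is a real Bott manifold corresponding to the $n\times n$ Bott matrix $$B=\begin{bmatrix}0&1&\cdots&1\\0&0&\cdots&0\\ \vdots&\vdots&\ddots&\vdots\\0&0&\cdots&0\end{bmatrix}$$ (first row $(0,1,\dots,1)$, all other rows zero), i.e. $K_n$ is homeomorphic to $M(B)$. In particular, $K_n$ is homeomorphic to the small cover $X(I^n,\chi)$, where $\chi:\{F_1,\dots,F_{2n}\}\to\mathbb{Z}_2^n$ is the characteristic function on the facets of $I^n$ given by $\chi(F_i)=\chi(F_{n+i})=e_i$ for $2\le i\le n$, $\chi(F_1)=e_1$, and $\chi(F_{n+1})=\sum_{i=1}^n e_i$.
   Context: The $n$-dimensional Klein bottle is $K_n=(S^1)^n/\big((z_1,\dots,z_{n-1},z_n)\sim(\bar z_1,\dots,\bar z_{n-1},-z_n)\big)$, where $S^1\subset\mathbb{C}$ is the unit circle. Bott matrix: a binary ($0/1$) square matrix $A$ such that $A=PUP^{-1}$ for some permutation matrix $P$ and some strictly upper triangular binary matrix $U$. For $z\in S^1$ and $a\in\{0,1\}$ put $z(a)=z$ if $a=0$ and $z(a)=\bar z$ if $a=1$. For an $n\times n$ Bott matrix $A$ with $(i,j)$ entry $A^i_j$, define for $1\le i\le n$ the involution $a_i$ of $(S^1)^n$ by $$a_i(z_1,\dots,z_n)=(z_1(A^i_1),\dots,z_{i-1}(A^i_{i-1}),-z_i,z_{i+1}(A^i_{i+1}),\dots,z_n(A^i_n)).$$ These involutions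 commute and generate a group $G(A)\cong\mathbb{Z}_2^n$ acting freely on $(S^1)^n$. The real Bott manifold associated with $A$ is $M(A)=(S^1)^n/G(A)$. $I^n=[-1,1]^n$ has facets $F_i=\{x\in I^n: x_i=-1\}$ and $F_{n+i}=\{x\in I^n: x_i=1\}$, $1\le i\le n$. $e_1,\dots,e_n$ is the standard basis of $\mathbb{Z}_2^n$. A characteristic function for an $n$-dimensional simple polytope $P$ is a map $\chi$ from its set of facets to $\mathbb{Z}_2^n$ such that for each vertex $v=F_{i_1}\cap\dots\cap F_{i_n}$ the vectors $\chi(F_{i_1}),\dots,\chi(F_{i_n})$ form a basis of $\mathbb{Z}_2^n$. The small cover is $X(P,\chi)=(\mathbb{Z}_2^n\times P)/\sim$, where $(t,p)\sim(u,q)$ iff $p=q$ and $t^{-1}u$ lies in the subgroup of $\mathbb{Z}_2^n$ generated by the vectors $\chi(F)$ over all facets $F$ of $P$ containing $q$. *)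

(* Defs.v *)
From HB Require Import structures.
From Stdlib Require Import Relations.
From mathcomp Require Import all_boot all_order all_algebra all_fingroup.
From mathcomp Require Import complex.
From mathcomp Require Import all_classical all_reals all_analysis.

Set Implicit Arguments.
Unset Strict Implicit.
Unset Printing Implicit Defensive.

Import Order.TTheory GRing.Theory Num.Theory.
Import numFieldNormedType.Exports.

Local Open Scope classical_set_scope.
Local Open Scope ring_scope.

Definition homeomorphic (X Y : topologicalType) : Prop :=
  exists (f : X -> Y) (g : Y -> X),
    [/\ continuous f, continuous g, cancel f g & cancel g f].

(* The quotient of X by the smallest equivalence relation containing r, with
   the quotient topology; if r is an equivalence relation this is X / r. *)
Section Quotient.
Context {X : topologicalType} (r : X -> X -> Prop).

Definition quot_rel : rel X := fun x y => `[< clos_refl_sym_trans X r x y >].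

Lemma quot_rel_refl : reflexive quot_rel.
Proof. by move=> x; apply/asboolP; exact: rst_refl. Qed.

Lemma quot_rel_sym : symmetric quot_rel.
Proof.
by move=> x y; apply/idP/idP => /asboolP ?; apply/asboolP; exact: rst_sym.
Qed.

Lemma quot_rel_trans : transitive quot_rel.
Proof.
by move=> y x z /asboolP xy /asboolP yz; apply/asboolP; exact: rst_trans yz.
Qed.

Canonical quot_equiv :=
  EquivRel quot_rel quot_rel_refl quot_rel_sym quot_rel_trans.

Definition quotient_space : topologicalType :=
  quotient_topology {eq_quot quot_equiv}%qT.

End Quotient.

(* The group of bijections of T generated by S. *)
Inductive gen_group (T : Type) (S : set (T -> T)) : set (T -> T) :=
| gen_id : gen_group S id
| gen_mul f g : S f -> gen_group S g -> gen_group S (f \o g)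
| gen_inv f g : gen_group S f -> cancel f g -> cancel g f ->
    gen_group S g.

Section Torus.
Variable R : realType.

(* R[i]^o is R[i] with the topology of the norm of R[i]. *)
Definition circle : set R[i]^o := [set z | `|z| = 1].

Lemma circle_opp_subproof (z : circle) : - \val z \in circle.
Proof. by case: z => z /= /set_mem zP; apply/mem_set; rewrite /circle /= normrN. Qed.

Definition circle_opp (z : circle) : circle :=
  exist _ (- \val z) (circle_opp_subproof z).

Lemma circle_conj_subproof (z : circle) : conjc (\val z) \in circle.
Proof. by case: z => z /= /set_mem zP; apply/mem_set; rewrite /circle /= normcJ. Qed.

Definition circle_conj (z : circle) : circle :=
  exist _ (conjc (\val z)) (circle_conj_subproof z).

(* z(a) *)
Definition twist (a : 'F_2) (z : circle) : circle :=
  if a == 0 then z else circle_conj z.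

Definition torus (n : nat) : topologicalType := 'rV[circle]_n.

Definition klein_map (n : nat) (z : torus n) : torus n :=
  \row_j (if j.+1 == n then circle_opp (z 0 j) else circle_conj (z 0 j)).

Definition klein (n : nat) : topologicalType :=
  quotient_space (fun z w : torus n => w = klein_map z).

Definition bott_involution (n : nat) (A : 'M['F_2]_n) (i : 'I_n)
    (z : torus n) : torus n :=
  \row_j (if j == i then circle_opp (z 0 j) else twist (A i j) (z 0 j)).

Definition bott_group (n : nat) (A : 'M['F_2]_n) : set (torus n -> torus n) :=
  gen_group (range (bott_involution A)).

Definition real_bott (n : nat) (A : 'M['F_2]_n) : topologicalType :=
  quotient_space (fun z w : torus n => exists2 g, bott_group A g & w = g z).

End Torus.

Definition strictly_upper (n : nat) (U : 'M['F_2]_n) : Prop :=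
  forall i j : 'I_n, (j <= i)%N -> U i j = 0.

(* Binary matrices are matrices over 'F_2: conjugating by a permutation matrix
   only permutes the entries, so the ring in which P U P^-1 is computed is
   immaterial. *)
Definition bott_matrix (n : nat) (A : 'M['F_2]_n) : Prop :=
  exists (s : 'S_n) (U : 'M['F_2]_n),
    strictly_upper U /\ A = perm_mx s *m U *m invmx (perm_mx s).

Definition klein_matrix (n : nat) : 'M['F_2]_n :=
  \matrix_(i, j) ((i == 0%N :> nat) && (j != 0%N :> nat))%:R.

(* An n-dimensional simple polytope P in R^n is given with the family F of its
   facets, indexed without repetition by a finite type J. *)
Section SmallCover.
Variables (R : realType) (n : nat) (P : set 'rV[R]_n).
Variables (J : finType) (F : J -> set 'rV[R]_n) (chi : J -> 'rV['F_2]_n).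

Definition characteristic_function : Prop :=
  forall (K : {set J}) (v : 'rV[R]_n), #|K| = n ->
    \bigcap_(j in [set` K]) F j = [set v] ->
    basis_of fullv [seq chi j | j <- enum K].

(* The subgroup of the additive group Z_2^n, written multiplicatively, generated
   by the chi j over the facets F j containing q. *)
Definition facet_group (q : 'rV[R]_n) : {group 'rV['F_2]_n} :=
  <<[set chi j | j : J & `[< F j q >]]%SET>>%G.

Definition small_cover : topologicalType :=
  quotient_space (fun x y : discrete_topology 'rV['F_2]_n * P =>
    x.2 = y.2 /\ (x.1^-1 * y.1)%g \in facet_group (\val y.2)).

End SmallCover.

Definition cube (R : realType) (n : nat) : set 'rV[R]_n :=
  [set x | forall i, -1 <= x 0 i <= 1].

(* Of the 2n facets, those indexed by lshift n i are x_i = -1 and those indexed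
   by rshift n i are x_i = 1. *)
Definition cube_facet (R : realType) (n : nat) (k : 'I_(n + n)) :
    set 'rV[R]_n :=
  [set x | cube x /\
    match fintype.split k with inl i => x 0 i = -1 | inr i => x 0 i = 1 end].

Definition unit_vec (n : nat) (i : 'I_n) : 'rV['F_2]_n := delta_mx 0 i.

Definition klein_chi (n : nat) (k : 'I_(n + n)) : 'rV['F_2]_n :=
  match fintype.split k with
  | inl i => unit_vec i
  | inr i => if i == 0%N :> nat then \sum_(j < n) unit_vec j else unit_vec i
  end.

(* Main.v *)
(* Both homeomorphisms come from one principle: let f : X -> Y be a continuous
   map from a compact space to a Hausdorff space with a continuous involution k,
   such that every y is f x or k (f x) for some x. If x and x' are identified by
   r exactly when f x' is f x or k (f x), then X / r is homeomorphic to
   Y / (y ~ k y), since f and k are closed maps. Here Y is the torus and k is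
   the involution defining K_n.
   For M(B), X is the torus and f (w_1, ..., w_n) = (w_2^2, ..., w_n^2, w_1):
   squaring divides out a_2, ..., a_n, and a_1 becomes k.
   For the small cover, f (t, x) takes x_i (i > 1) to the point of the upper or
   lower half circle (according to t_i) over x_i; the two intervals of the first
   coordinate, glued at x_1 = -1, parametrize the upper half of the last circle
   of the torus, whose ends are the two copies of the facet x_1 = 1. *)

Require Import Defs.
From Stdlib Require Import Relations.
From mathcomp Require Import all_boot all_order all_algebra all_fingroup.
From mathcomp Require Import complex.
From mathcomp Require Import all_classical all_reals all_analysis.
From mathcomp Require Import lra.

Set Implicit Arguments.
Unset Strict Implicit.
Unset Printing Implicit Defensive.

Import Order.TTheory GRing.Theory Num.Theory.
Import numFieldNormedType.Exports.

Local Open Scope classical_set_scope.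
Local Open Scope quotient_scope.
Local Open Scope ring_scope.

(** * General topology of subspaces and spaces of rows *)

(** Applied to continuous maps that jointly separate points, this transfers the Hausdorff property
    to subspaces and to spaces of rows. *)
Lemma cluster_nbhs_continuous (X Y : topologicalType) (g : X -> Y) (p q : X) :
  hausdorff_space Y -> continuous g -> cluster (nbhs p) q -> g p = g q.
Proof.
move=> hY cg pq; apply: hY => A B /cg gA /cg gB.
by have [x [Ax Bx]] := pq _ _ gA gB; exists (g x).
Qed.

(** A filter on the subtype, pushed forward to [X], contains [A] and so clusters at a point of [A];
    neighbourhoods in the subtype are traces of open sets of [X]. *)
Lemma compact_set_type (X : topologicalType) (A : set X) :
  compact A -> compact [set: A].
Proof.
move=> cA F FF _.
have FA : (set_val @ F) A by apply: (@filterE _ F) => x; exact: set_valP.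
have [p [Ap clp]] : A `&` cluster (set_val @ F) !=set0 by exact: cA FA.
pose p' : A := exist _ p (mem_set Ap).
exists p'; split=> // G B FG [_ [[W oW <-] Wp] WB].
have FGv : (set_val @ F) (set_val @` G) 
  by apply: (@filterS _ F _ G) => // x Gx; exists x.
have [y [[x Gx <-] Wx]] := clp _ _ FGv (open_nbhs_nbhs (conj oW Wp)).
by exists x; split=> //; exact: WB.
Qed.

Lemma continuous_set_type (X Y : topologicalType) (A : set Y) (f : X -> A) :
  continuous (fun x => \val (f x)) -> continuous f.
Proof. by move=> cf; exact: (@continuous_comp_initial _ _ _ set_val f cf). Qed.

Lemma continuous_set_val (X : topologicalType) (A : set X) :
  continuous (fun x : A => \val x).
Proof. exact: (@initial_continuous A X set_val). Qed.

Lemma continuous_row (X T : topologicalType) n (f : X -> 'rV[T]_n) :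
  (forall j, continuous (fun x => f x 0 j)) -> continuous f.
Proof.
move=> cf x B [P fP PB].
apply: (@filterS _ _ _ [set y | forall j, P 0 j (f y 0 j)]).
  by move=> y Py; apply: PB => i j; rewrite ord1.
by apply: filter_forall => j; exact: (cf j x _ (fP 0 j)).
Qed.

Lemma continuous_entry (T : topologicalType) n (j : 'I_n) :
  continuous (fun M : 'rV[T]_n => M 0 j).
Proof.
move=> M B MB; exists (fun i k => if k == j then B else setT).
  move=> i k; case: eqP => [->|_]; last exact: filterT.
  by rewrite ord1.
by move=> N /= /(_ 0 j); rewrite eqxx.
Qed.

(** * Quotients of a compact space and quotients by an involution *)

Lemma clos_involution (Y : Type) (k : Y -> Y) (y y' : Y) : involutive k ->
  clos_refl_sym_trans Y (fun y y' => y' = k y) y y' <-> y' = y \/ y' = k y.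
Proof.
move=> kK; split=> [|[->|->]]; last 2 first.
- exact: rst_refl.
- exact: rst_step.
elim=> [a b ->|a|a b _ [->|->]|a b c _ + _]; [by right|by left|by left| |].
  by right; rewrite kK.
by move=> [->|->] [->|->]; rewrite ?kK; [left|right|right|left].
Qed.

Section InvolutionQuotient.
Variables (X Y : topologicalType) (rX : X -> X -> Prop).
Variables (f : X -> Y) (k : Y -> Y).
Hypotheses (cptX : compact [set: X]) (hausY : hausdorff_space Y).
Hypotheses (cf : continuous f) (ck : continuous k) (kK : involutive k).
Hypothesis f_onto : forall y, exists x, f x = y \/ f x = k y.
Hypothesis rX_f : forall x x', rX x x' -> f x' = f x \/ f x' = k (f x).
Hypothesis f_rX : forall x x', f x' = f x \/ f x' = k (f x) ->
  clos_refl_sym_trans X rX x x'.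

Local Notation rY := (fun y y' : Y => y' = k y).
Local Notation QX := (quotient_space rX).
Local Notation QY := (quotient_space rY).

Let clos_rX x x' :
  clos_refl_sym_trans X rX x x' <-> f x' = f x \/ f x' = k (f x).
Proof.
split; last exact: f_rX.
elim=> [||a b _|a b c _ + _]; [exact: rX_f|by left| |].
  by move=> [->|->]; [left|right; rewrite kK].
by move=> [->|->] [->|->]; rewrite ?kK; [left|right|right|left].
Qed.

Let piXP x x' : \pi_QX x = \pi_QX x' <-> f x' = f x \/ f x' = k (f x).
Proof.
rewrite -clos_rX; split; first by move/eqmodP/asboolP.
by move=> ?; apply/eqmodP/asboolP.
Qed.

Let piYP y y' : \pi_QY y = \pi_QY y' <-> y' = y \/ y' = k y.
Proof.
rewrite -clos_involution//; split; first by move/eqmodP/asboolP.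
by move=> ?; apply/eqmodP/asboolP.
Qed.

(** A bare choice, with no continuity claimed; only its composite with the projection to [QX] will
    be continuous. *)
Let lift y : X := projT1 (cid (f_onto y)).

Let liftP y : f (lift y) = y \/ f (lift y) = k y.
Proof. exact: projT2 (cid (f_onto y)). Qed.

Let closed_image (C : set X) : closed C -> closed (f @` C).
Proof.
move=> clC; apply: compact_closed => //; apply: continuous_compact.
  exact: continuous_subspaceT.
exact: subclosed_compact clC cptX _.
Qed.

Lemma homeomorphic_involution_quotient : homeomorphic QY QX.
Proof.
(* Both maps go through chosen representatives; [Gpi] and [Fpi] show that the choice does not
   matter. *)
pose F (q : QY) : QX := \pi_QX (lift (generic_quotient.repr q)).
pose G (p : QX) : QY := \pi_QY (f (generic_quotient.repr p)).
have Gpi x : G (\pi_QX x) = \pi_QY (f x).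
  apply/piYP.
  by have /piXP := reprK (\pi_QX x).
have Fpi y : F (\pi_QY y) = \pi_QX (lift y).
  apply/piXP.
  have /piYP := reprK (\pi_QY y).
  move: (generic_quotient.repr _) => r.
  by case: (liftP y) (liftP r) => -> [] -> [] ->; rewrite ?kK; auto.
exists F, G; split.
- apply/quotient_continuous; rewrite (_ : F \o _ = \pi_QX \o lift); last first.
    by apply/funext => y; exact: Fpi.
  apply/continuous_closedP => C clC.
  pose D := \pi_QX @^-1` C.
  have clD : closed D.
    exact: (continuous_closedP _).1 (@pi_continuous _ _) _ clC.
  have -> : (\pi_QX \o lift) @^-1` C = f @` D `|` k @^-1` (f @` D).
    apply/seteqP; split=> y /=.
      move=> Cy; case: (liftP y) => fy; [left|right]; exists (lift y) => //.
    by move=> [] [x Dx fx]; rewrite /D /= in Dx;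
      rewrite (_ : \pi_QX _ = \pi_QX x)//; apply/piXP; rewrite fx;
      case: (liftP y) => ->; rewrite ?kK; auto.
  apply: closedU; first exact: closed_image.
  exact: (continuous_closedP _).1 ck _ (closed_image clD).
- apply/quotient_continuous; rewrite (_ : G \o _ = \pi_QY \o f); last first.
    by apply/funext => x; exact: Gpi.
  by move=> x; apply: continuous_comp; [exact: cf|exact: pi_continuous].
- move=> q; rewrite -[q]reprK Fpi Gpi; apply/piYP.
  by case: (liftP (generic_quotient.repr q)) => ->; rewrite ?kK; auto.
- move=> p; rewrite -[p]reprK Gpi Fpi; apply/piXP.
  by case: (liftP (f (generic_quotient.repr p))) => ->; rewrite ?kK; auto.
Qed.

End InvolutionQuotient.

(** * The unit circle: topology, squaring and half circles *)

Section Circle.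
Variable R : realType.
Local Notation C := (R[i]^o).
Local Notation S1 := (@circle R).

Lemma circleP (z : S1) : `|\val z| = 1 :> R[i].
Proof. exact: (set_valP z). Qed.

Lemma circle_sqr (z : S1) :
  complex.Re (\val z) ^+ 2 + complex.Im (\val z) ^+ 2 = 1.
Proof.
by apply: complexI; rewrite /= add_Re2_Im2 circleP expr1n.
Qed.

Lemma circle_Re_le1 (z : S1) : `|complex.Re (\val z)| <= 1.
Proof.
rewrite -(@expr_le1 _ 2)// real_normK ?num_real//.
by rewrite -(circle_sqr z) lerDl sqr_ge0.
Qed.

Lemma hausdorff_circle : hausdorff_space S1.
Proof.
move=> z w zw; apply: val_inj.
apply: (@cluster_nbhs_continuous _ C (fun x : S1 => \val x)) zw.
  exact: norm_hausdorff.
exact: continuous_set_val.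
Qed.

Lemma hausdorff_torus n : hausdorff_space (torus R n).
Proof.
move=> z w zw; apply/rowP => j.
apply: (@cluster_nbhs_continuous _ _ (fun M : torus R n => M 0 j)) zw.
  exact: hausdorff_circle.
exact: continuous_entry.
Qed.

Lemma continuous_real_complex : continuous (fun x : R => x%:C%C : C).
Proof.
move=> x; apply/cvgrPdist_lt => e e0.
(* In the partial order of [R[i]], a positive element has zero imaginary part. *)
have [e' e'0 ->] : exists2 e' : R, 0 < e' & e = e'%:C%C.
  by case: e e0 => a b; rewrite ltcE /= => /andP[/eqP-> a0]; exists a.
have /cvgrPdist_lt /(_ e' e'0) : y @[y --> x] --> x by exact: cvg_id.
apply: filterS => y; rewrite -ltcR; congr (_ < _).
by rewrite -rmorphB /= normc_def /= expr0n addr0 sqrtr_sqr.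
Qed.

Lemma continuous_complex (X : topologicalType) (u v : X -> R) :
  continuous u -> continuous v -> continuous (fun x => (u x +i* v x)%C : C).
Proof.
move=> cu cv; rewrite (_ : (fun x => _) =
    fun x => (u x)%:C%C + 'i%C * (v x)%:C%C :> C); last first.
  by apply/funext => x; rewrite [LHS]complexE.
move=> x; apply: (@cvgD _ C).
  exact: (continuous_comp (cu x) (@continuous_real_complex _)).
apply: (@cvgM R[i]); first exact: cvg_cst.
exact: (continuous_comp (cv x) (@continuous_real_complex _)).
Qed.

(** Conjugation is an isometry. *)
Lemma continuous_conjc : continuous (@conjc R : C -> C).
Proof.
move=> x; have FF := @nbhs_filter C x; apply/cvgrPdist_lt => e e0.
have /cvgrPdist_lt /(_ e e0) : y @[y --> (x : C)] --> (x : C) by exact: cvg_id.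
apply: (@filterS _ (nbhs (x : C))) => y.
by rewrite -[X in X < _ -> _]normcJ rmorphB.
Qed.

Lemma continuous_circle_map (g : C -> C) (h : S1 -> S1) :
  continuous g -> (forall z, \val (h z) = g (\val z)) -> continuous h.
Proof.
move=> cg hg; apply: continuous_set_type => z.
rewrite (_ : (fun x => _) = g \o (fun x : S1 => \val x)); last first.
  by apply/funext => x; exact: hg.
by apply: continuous_comp; [exact: continuous_set_val|exact: cg].
Qed.

Lemma continuous_circle_opp : continuous (@circle_opp R).
Proof.
apply: (@continuous_circle_map -%R) => // z.
exact: (@opp_continuous C z).
Qed.

Lemma continuous_circle_conj : continuous (@circle_conj R).
Proof. exact: continuous_circle_map continuous_conjc _. Qed.

Lemma circle_oppK : involutive (@circle_opp R).
Proof. by move=> z; apply: val_inj; rewrite /= opprK. Qed.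

Lemma circle_conjK : involutive (@circle_conj R).
Proof. by move=> z; apply: val_inj; rewrite /= conjcK. Qed.

Lemma circle_sq_subproof (z : S1) : (\val z ^+ 2 : C) \in @circle R.
Proof. by apply/mem_set; rewrite /circle /= normrX circleP expr1n. Qed.

Definition circle_sq (z : S1) : S1 :=
  exist _ (\val z ^+ 2 : C) (circle_sq_subproof z).

Lemma continuous_circle_sq : continuous circle_sq.
Proof.
apply: (@continuous_circle_map (fun z => z ^+ 2)) => // z.
by apply: (@continuousM R[i] C id id z); exact: cvg_id.
Qed.

Lemma circle_sq_surj (z : S1) : exists w, circle_sq w = z.
Proof.
have sP : (sqrtC (\val z : R[i]) : C) \in @circle R.
  apply/mem_set; rewrite /circle /=.
  by apply/eqP; rewrite -(@pexpr_eq1 _ _ 2)// -normrX sqrtCK circleP.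
by exists (exist (fun w => w \in S1) _ sP); apply: val_inj; rewrite /= sqrtCK.
Qed.

Lemma circle_sq_eq (z w : S1) :
  circle_sq z = circle_sq w -> z = w \/ z = circle_opp w.
Proof.
move=> /(congr1 val) /= /eqP; rewrite eqf_sqr => /orP[] /eqP zw; [left|right];
  exact: val_inj.
Qed.

Lemma circle_sq_opp z : circle_sq (circle_opp z) = circle_sq z.
Proof. by apply: val_inj; rewrite /= sqrrN. Qed.

Lemma circle_sq_conj z : circle_sq (circle_conj z) = circle_conj (circle_sq z).
Proof. by apply: val_inj; rewrite /= rmorphXn. Qed.

Lemma circle1_subproof : (1 : C) \in @circle R.
Proof. by apply/mem_set; rewrite /circle /= normr1. Qed.

Lemma half_circle_subproof (b : bool) (x : R) : `|x| <= 1 ->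
  ((x +i* ((-1) ^+ b * Num.sqrt (1 - x ^+ 2)))%C : C) \in @circle R.
Proof.
move=> x1; apply/mem_set; rewrite /circle /= normc_def /=.
rewrite exprMn sqrr_sign mul1r sqr_sqrtr; last first.
  by rewrite subr_ge0 -real_normK ?num_real// expr_le1.
by rewrite addrC subrK sqrtr1.
Qed.

(* Upper half circle for [b = false], lower for [b = true]; 1 when |x| > 1. *)
Definition half_circle (b : bool) (x : R) : S1 :=
  if pselect (`|x| <= 1) is left x1 
  then exist (fun w => w \in S1) _ (half_circle_subproof b x1)
  else exist (fun w => w \in S1) _ circle1_subproof.

Lemma val_half_circle b x : `|x| <= 1 ->
  \val (half_circle b x) = (x +i* ((-1) ^+ b * Num.sqrt (1 - x ^+ 2)))%C.
Proof. by rewrite /half_circle; case: pselect. Qed.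

Lemma continuous_half_circle (X : topologicalType) (b : bool) (u : X -> R) :
  (forall x, `|u x| <= 1) -> continuous u ->
  continuous (fun x => half_circle b (u x)).
Proof.
move=> u1 cu; apply: continuous_set_type.
rewrite (_ : (fun x => _) =
    fun x => (u x +i* ((-1) ^+ b * Num.sqrt (1 - u x ^+ 2)))%C); last first.
  by apply/funext => x; exact: val_half_circle.
apply: continuous_complex => // x; apply: cvgM; first exact: cvg_cst.
apply: continuous_comp; last exact: sqrt_continuous.
by apply: cvgB; [exact: cvg_cst|apply: cvgM; exact: cu].
Qed.

(** On the circle the absolute value of the imaginary part is the square root of one minus the
    squared real part, so only its sign is left to record. *)
Lemma half_circleE (z : S1) :
  z = half_circle (complex.Im (\val z) < 0) (complex.Re (\val z)).
Proof.
have zS := circle_sqr z; have z1 := circle_Re_le1 z.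
apply: val_inj; rewrite val_half_circle//
  -[X in X - _]zS addrAC subrr add0r sqrtr_sqr.
case: (\val z) => a b /=; congr (_ +i* _)%C.
by rewrite mulr_sign; case: (ltrP b 0) => b0;
  [rewrite ltr0_norm ?opprK|rewrite ger0_norm].
Qed.

Lemma circle_conj_half_circle b x :
  circle_conj (half_circle b x) = half_circle (~~ b) x.
Proof.
apply: val_inj; rewrite /= /half_circle; case: pselect => x1 /=.
  by congr (_ +i* _)%C; rewrite !mulr_sign; case: b; rewrite ?opprK.
by rewrite oppr0.
Qed.

(** The two half circles meet at their ends, where the square root vanishes. *)
Lemma half_circle_end b c x : `|x| = 1 -> half_circle b x = half_circle c x.
Proof.
move=> x1; apply: val_inj; rewrite !val_half_circle ?x1//.
by rewrite -real_normK ?num_real// x1 expr1n subrr sqrtr0 !mulr0.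
Qed.

Lemma circle_opp_half_circle b x : `|x| = 1 ->
  circle_opp (half_circle b x) = half_circle b (- x).
Proof.
move=> x1; apply: val_inj; rewrite /= !val_half_circle ?normrN ?x1//.
rewrite sqrrN -real_normK ?num_real// x1 expr1n subrr sqrtr0 !mulr0.
by apply/eqP; rewrite eq_complex /= oppr0 !eqxx.
Qed.

Lemma half_circle_inj b c x y : `|x| <= 1 -> `|y| <= 1 ->
  half_circle b x = half_circle c y ->
  x = y /\ (b = c \/ `|x| = 1).
Proof.
move=> x1 y1 /(congr1 val) /=; rewrite !val_half_circle// => -[xy].
rewrite -xy !mulr_sign => bc.
split=> //; have [x1'|x1'] := eqVneq `|x| 1; [by right|left].
(* Away from the ends the imaginary part is nonzero, so its sign determines the half. *)
have s0 : 0 < Num.sqrt (1 - x ^+ 2).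
  rewrite sqrtr_gt0 subr_gt0 -real_normK ?num_real// expr_lt1//.
  by rewrite lt_neqAle x1'.
by case: b c bc => [] []//= bc; exfalso; lra.
Qed.

(** Negation maps the upper half circle to the lower one, and these share only the points 1 and
    -1. *)
Lemma circle_opp_half_circle_false x y : `|x| <= 1 -> `|y| <= 1 ->
  circle_opp (half_circle false x) = half_circle false y -> `|x| = 1 /\ y = - x.
Proof.
move=> x1 y1 /(congr1 val) /=; rewrite !val_half_circle// => -[xy].
rewrite -xy !mul1r sqrrN => s0; split=> //.
have [//|x1'] := eqVneq `|x| 1.
have : 0 < Num.sqrt (1 - x ^+ 2).
  rewrite sqrtr_gt0 subr_gt0 -real_normK ?num_real// expr_lt1//.
  by rewrite lt_neqAle x1'.
lra.
Qed.

End Circle.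

(** Each slice over a point of the discrete factor is open, so continuity can be checked slice by
    slice. *)
Lemma continuous_discrete_prod (T : choiceType) (X Y : topologicalType)
    (g : T -> X -> Y) : (forall t, continuous (g t)) ->
  continuous (fun p : discrete_topology T * X => g p.1 p.2).
Proof.
move=> cg [t x] B /cg gB; exists ([set t], g t @^-1` B).
  by split => //=; rewrite /nbhs /= => _ ->.
by move=> [s y] [/= -> By].
Qed.

(** * The prism (copies of the cube indexed by $\mathbb{Z}_2^n$), the torus and its involution *)

Section Torus.
Variables (R : realType) (n : nat).
Local Notation S1 := (@circle R).
Local Notation prism := (discrete_topology 'rV['F_2]_n * @cube R n)%type.

Lemma cube_le1 (x : @cube R n) i : `|\val x 0 i| <= 1.
Proof. by rewrite ler_norml; exact: (set_valP x) i. Qed.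

Lemma compact_prism : compact [set: prism].
Proof.
rewrite -setXTT; apply: compact_setX.
  by apply: finite_compact; exact: (@finite_finset 'rV['F_2]_n setT).
apply: compact_set_type.
rewrite (_ : @cube R n = [set v | forall i, `[(-1 : R), 1]%classic (v ord0 i)]).
  apply: (@rV_compact R n (fun=> `[-1, 1]%classic)) => i.
  exact: segment_compact.
by apply/seteqP; split=> v vP i; have := vP i; rewrite /= in_itv.
Qed.

Lemma continuous_cube_entry i : continuous (fun x : @cube R n => \val x 0 i).
Proof.
move=> x; apply: (@continuous_comp _ _ _ (fun x : @cube R n => \val x)
  (fun v : 'rV[R]_n => v 0 i)).
  exact: continuous_set_val.
exact: coord_continuous.
Qed.

(** Each circle is the union of two half circles over [-1, 1], so the torus is a continuous image of
    the compact [prism]. *)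
Lemma compact_torus : compact [set: torus R n].
Proof.
pose h (p : prism) : torus R n :=
  \row_j half_circle (p.1 0 j != 0) (\val p.2 0 j).
rewrite (_ : [set: _] = h @` [set: prism]).
  apply: continuous_compact compact_prism; apply: continuous_subspaceT.
  apply: (@continuous_discrete_prod _ (@cube R n) _ (fun t x => h (t, x))) => t.
  apply: continuous_row => j.
  pose hj (x : @cube R n) := half_circle (t 0 j != 0) (\val x 0 j).
  rewrite (_ : (fun x => _) = hj); last by apply/funext => x; rewrite mxE.
  apply: continuous_half_circle => [x|]; first exact: cube_le1.
  exact: continuous_cube_entry.
apply/seteqP; split=> // z _.
have xP : (\row_j complex.Re (\val (z 0 j)) : 'rV[R]_n) \in @cube R n.
  apply/mem_set => j; rewrite mxE -ler_norml.
  exact: circle_Re_le1.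
pose t : 'rV['F_2]_n := \row_j (complex.Im (\val (z 0 j)) < 0)%R%:R.
exists (t, exist (fun x => x \in @cube R n) _ xP) => //.
apply/rowP => j; rewrite /h !mxE [RHS]half_circleE; congr half_circle.
by case: (_ < 0); rewrite ?oner_eq0 ?eqxx.
Qed.

(** The involution of $K_n$ singles out the last coordinate, [klein_matrix] and [klein_chi] the
    first. The cyclic shift [ordS] reconciles them: entry [j] of the target is computed from entry
    [ordS j] of the source. *)
Lemma ordS_eq0 (j : 'I_n) : (ordS j == 0%N :> nat) = (j.+1 == n).
Proof.
rewrite /=; have := ltn_ord j; rewrite leq_eqVlt => /orP[/eqP jn|jn].
  by rewrite jn modnn !eqxx.
by rewrite modn_small// (ltn_eqF jn).
Qed.

Lemma klein_mapE (z : torus R n) j : klein_map z 0 j =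
  if ordS j == 0%N :> nat then circle_opp (z 0 j) else circle_conj (z 0 j).
Proof. by rewrite mxE ordS_eq0. Qed.

Lemma klein_mapK : involutive (@klein_map R n).
Proof.
move=> z; apply/rowP => j; rewrite mxE [klein_map z 0 j]mxE.
by case: (_ == n); rewrite ?circle_oppK ?circle_conjK.
Qed.

Lemma continuous_klein_map : continuous (@klein_map R n).
Proof.
apply: continuous_row => j.
rewrite (_ : (fun z => _) =
    (if j.+1 == n then @circle_opp R else @circle_conj R) \o
    (fun z : torus R n => z 0 j)); last first.
  by apply/funext => z; rewrite /= mxE; case: ifP.
move=> z; apply: continuous_comp; first exact: continuous_entry.
by case: ifP => _; [exact: continuous_circle_opp|exact: continuous_circle_conj].
Qed.

End Torus.

(** * The Klein bottle as a real Bott manifold *)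

Section KleinBott.
Variables (R : realType) (n : nat) (n_gt0 : (0 < n)%N).
Local Notation K := (klein_matrix n).

Definition square_map (w : torus R n) : torus R n :=
  \row_j (if ordS j == 0%N :> nat then w 0 (ordS j)
          else circle_sq (w 0 (ordS j))).

Lemma continuous_square_map : continuous square_map.
Proof.
apply: continuous_row => j.
rewrite (_ : (fun z => _) = (if ordS j == 0%N :> nat then id else @circle_sq R)
    \o (fun z : torus R n => z 0 (ordS j))); last first.
  by apply/funext => z; rewrite /= mxE; case: ifP.
move=> z; apply: continuous_comp; first exact: continuous_entry.
by case: ifP => _; [exact: cvg_id|exact: continuous_circle_sq].
Qed.

Lemma square_map_onto z : exists w, square_map w = z.
Proof.
exists (\row_i if i == 0%N :> nat then z 0 (ord_pred i)
               else projT1 (cid (circle_sq_surj (z 0 (ord_pred i))))).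
apply/rowP => j; rewrite !mxE; case: (_ == 0%N); first by rewrite ordSK.
by rewrite (projT2 (cid (circle_sq_surj _))) ordSK.
Qed.

Lemma square_map_eq w w' : square_map w' = square_map w ->
  forall i, w' 0 i = w 0 i \/ i != 0%N :> nat /\ w' 0 i = circle_opp (w 0 i).
Proof.
move=> ww' i; move/rowP: ww' => /(_ (ord_pred i)); rewrite !mxE ord_predK.
case: ifPn => [_ ->|i0 /circle_sq_eq[]]; by [left|auto].
Qed.

(** Row 0 of the matrix conjugates all other coordinates, and conjugation commutes with squaring;
    coordinate 0 is negated and is not squared. *)
Lemma square_map_bott0 (i : 'I_n) w : i == 0%N :> nat ->
  square_map (bott_involution K i w) = klein_map (square_map w).
Proof.
move=> i0; apply/rowP => j; rewrite klein_mapE !mxE i0 /=.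
have -> : (ordS j == i) = (ordS j == 0%N :> nat) by rewrite -(eqP i0).
case: (_ == 0%N) => //=.
by rewrite /twist oner_eq0 circle_sq_conj.
Qed.

(** Row [i] is zero, so only the sign of one squared coordinate changes. *)
Lemma square_map_bott (i : 'I_n) w : i != 0%N :> nat ->
  square_map (bott_involution K i w) = square_map w.
Proof.
move=> i0; apply/rowP => j; rewrite !mxE (negbTE i0) andFb /twist eqxx.
have [->|//] := eqVneq (ordS j) i.
by rewrite (negbTE i0) circle_sq_opp.
Qed.

Lemma square_map_bott_group g w : bott_group K g ->
  square_map (g w) = square_map w \/
  square_map (g w) = klein_map (square_map w).
Proof.
move=> gK; elim: gK w => [w|_ g' [i _ <-] _ IH w|g' g'' _ IH g'K g''K w].
- by left.
- have [i0|i0] := eqVneq (i : nat) 0%N.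
    rewrite /comp square_map_bott0 ?i0//.
    by case: (IH w) => ->; rewrite ?klein_mapK; auto.
  by rewrite /comp square_map_bott.
(* Inverse case: [g' (g'' w) = w], and [klein_map] is its own inverse. *)
- by have := IH (g'' w); rewrite g''K => -[] ->; rewrite ?klein_mapK; auto.
Qed.

Local Notation rB :=
  (fun z w : torus R n => exists2 g, bott_group K g & w = g z).

Lemma bott_involution_rel i w : rB w (bott_involution K i w).
Proof.
exists (bott_involution K i) => //.
by apply: (@gen_mul _ _ (bott_involution K i) id); [exists i|exact: gen_id].
Qed.

Lemma square_map_fiber w w' : square_map w' = square_map w ->
  clos_refl_sym_trans _ rB w w'.
Proof.
move=> /square_map_eq ww'.
(* Interpolates from [w] to [w'], one coordinate at a time. Consecutive terms are equal or differ by
   the sign of a coordinate other than 0, hence by one [bott_involution]. *)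
pose u k : torus R n := \row_i if (i < k)%N then w' 0 i else w 0 i.
have <- : u n = w' by apply/rowP => i; rewrite mxE ltn_ord.
have wu0 : u 0%N = w by apply/rowP => i; rewrite mxE.
suff uk k : (k <= n)%N -> clos_refl_sym_trans _ rB (u 0%N) (u k).
  by rewrite -{1}wu0; exact: uk.
elim: k => [_|k IH kn]; first exact: rst_refl.
apply: rst_trans (IH (ltnW kn)) _; pose i := Ordinal kn.
have [wi|[i0 wi]] := ww' i.
  rewrite (_ : u k.+1 = u k); first exact: rst_refl.
  apply/rowP => j; rewrite !mxE ltnS leq_eqVlt; case: eqP => //= jk.
  by rewrite (_ : j = i) ?ltnn //; apply: val_inj.
apply: rst_step; rewrite (_ : u k.+1 = bott_involution K i (u k)).
  exact: bott_involution_rel.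
apply/rowP => j; rewrite !mxE (negbTE i0) andFb /twist eqxx ltnS leq_eqVlt.
rewrite -[in RHS]val_eqE /=; case: eqP => //= jk.
by rewrite (_ : j = i) ?ltnn //; apply: val_inj.
Qed.

Lemma klein_homeo_bott : homeomorphic (klein R n) (real_bott R K).
Proof.
apply: (@homeomorphic_involution_quotient _ _ _ square_map).
- exact: compact_torus.
- exact: hausdorff_torus.
- exact: continuous_square_map.
- exact: continuous_klein_map.
- exact: klein_mapK.
- by move=> z; have [w wz] := square_map_onto z; exists w; left.
- by move=> w w' [g gK ->]; exact: square_map_bott_group.
- move=> w w' [|ww']; first exact: square_map_fiber.
  (* The involution of index 0 induces [klein_map]; applying it to [w] first reduces to the fibre
     case. *)
  pose i0 := Ordinal n_gt0.
  apply: (@rst_trans _ _ _ (bott_involution K i0 w)).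
    by apply: rst_step; exact: bott_involution_rel.
  by apply: square_map_fiber; rewrite square_map_bott0.
Qed.

End KleinBott.

(** * The Klein bottle as a small cover of the cube *)

Lemma split_lshift m n (i : 'I_m) : fintype.split (lshift n i) = inl i.
Proof. exact: (unsplitK (inl i)). Qed.

Lemma split_rshift m n (i : 'I_n) : fintype.split (rshift m i) = inr i.
Proof. exact: (unsplitK (inr i)). Qed.

Lemma F2_addr1_neq0 (a : 'F_2) : (a + 1 != 0) = (a == 0).
Proof. by case: a => -[|[|a]]. Qed.

Lemma F2_natb_neq0 (b : bool) : (b%:R != 0 :> 'F_2) = b.
Proof. by case: b. Qed.

Lemma F2_neq0_inj (a b : 'F_2) : (a != 0) = (b != 0) -> a = b.
Proof. by case: a b => -[|[|a]] // ha [] [|[|b]] // hb _; apply: val_inj. Qed.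

Section SmallCoverKlein.
Variables (R : realType) (n : nat) (n_gt0 : (0 < n)%N).
Local Notation S1 := (@circle R).
Local Notation prism := (discrete_topology 'rV['F_2]_n * @cube R n)%type.
Local Notation i0 := (Ordinal n_gt0).

(* Identifies with [-1, 1] the two copies of [-1, 1], for b = false and b = true,
   glued at x = -1. *)
Definition half (b : bool) (x : R) : R := (-1) ^+ b * ((x + 1) / 2).

Lemma half_le1 b x : -1 <= x <= 1 -> `|half b x| <= 1.
Proof. by move=> /andP[? ?]; rewrite normrMsign ger0_norm; lra. Qed.

(** The images for [false] and [true] are [0, 1] and [-1, 0], which meet only at 0, the image of
    -1. *)
Lemma half_inj b c x y : -1 <= x <= 1 -> -1 <= y <= 1 ->
  half b x = half c y -> x = y /\ (b = c \/ x = -1).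
Proof.
rewrite /half !mulr_sign => /andP[x1 x2] /andP[y1 y2].
by case: b c => [] [] xy; (split; first lra); solve [by left | right; lra].
Qed.

Lemma continuous_half b : continuous (half b).
Proof.
move=> x; apply: (@cvgM _ _ (nbhs x)); first exact: cvg_cst.
apply: (@cvgM _ _ (nbhs x)); last exact: cvg_cst.
by apply: (@cvgD _ _ _ (nbhs x)); [exact: cvg_id|exact: cvg_cst].
Qed.

(** Coordinate 0 covers only the upper half circle; [klein_map], which negates the corresponding
    entry, supplies the lower half. *)
Definition prism_entry (i : 'I_n) (a : 'F_2) (x : R) : S1 :=
  if i == 0%N :> nat then half_circle false (half (a != 0) x)
  else half_circle (a != 0) x.

Definition prism_map (t : 'rV['F_2]_n) (x : @cube R n) : torus R n :=
  \row_j prism_entry (ordS j) (t 0 (ordS j)) (\val x 0 (ordS j)).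

Lemma cubeP (x : @cube R n) i : -1 <= \val x 0 i <= 1.
Proof. exact: (set_valP x) i. Qed.

Lemma continuous_prism_map : continuous (fun p : prism => prism_map p.1 p.2).
Proof.
apply: continuous_discrete_prod => t; apply: continuous_row => j.
pose i := ordS j.
pose h (x : @cube R n) := prism_entry i (t 0 i) (\val x 0 i).
rewrite (_ : (fun x => _) = h); last by apply/funext => x; rewrite mxE.
have [iE|iE] := boolP (i == 0%N :> nat).
  rewrite (_ : h = fun x => half_circle false (half (t 0 i != 0) (\val x 0 i))).
    apply: continuous_half_circle => [x|x].
      by apply: half_le1; exact: cubeP.
    apply: (@continuous_comp _ _ _ (fun x : @cube R n => \val x 0 i)).
      exact: continuous_cube_entry.
    exact: continuous_half.
  by apply/funext => x; rewrite /h /prism_entry iE.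
rewrite (_ : h = fun x => half_circle (t 0 i != 0) (\val x 0 i)).
  apply: continuous_half_circle => [x|]; first exact: cube_le1.
  exact: continuous_cube_entry.
by apply/funext => x; rewrite /h /prism_entry (negbTE iE).
Qed.

(** The condition under which [prism_map] does not see the bit [t 0 i]. *)
Definition folded (x : @cube R n) (i : 'I_n) : Prop :=
  if i == 0%N :> nat then \val x 0 i = -1 else `|\val x 0 i| = 1.

Lemma prism_map_fiber (t t' : 'rV['F_2]_n) x :
  (forall i, t' 0 i = t 0 i \/ folded x i) -> prism_map t' x = prism_map t x.
Proof.
move=> tt'; apply/rowP => j; rewrite !mxE; move: (ordS j) => i.
have [->//|] := tt' i; rewrite /folded /prism_entry.
case: (_ == 0%N) => [->|x1]; first by rewrite /half addNr mul0r !mulr0.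
exact: half_circle_end.
Qed.

Lemma prism_map_inj (t t' : 'rV['F_2]_n) x x' :
  prism_map t' x' = prism_map t x ->
  x' = x /\ forall i, t' 0 i = t 0 i \/ folded x i.
Proof.
move=> E.
suff ti i : \val x' 0 i = \val x 0 i /\ (t' 0 i = t 0 i \/ folded x i).
  split=> [|i]; last by have [] := ti i.
  by apply: val_inj; apply/rowP => i; have [] := ti i.
move/rowP: E => /(_ (ord_pred i)); rewrite !mxE ord_predK /prism_entry /folded.
case: (_ == 0%N) => E.
  have [hE _] := half_circle_inj (half_le1 _ (cubeP x' i))
    (half_le1 _ (cubeP x i)) E.
  have [xx' [/F2_neq0_inj|x1]] := half_inj (cubeP x' i) (cubeP x i) hE.
    by split; [|left].
  by split; [|right; rewrite -xx'].
have [xx' [/F2_neq0_inj|x1]] :=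
  half_circle_inj (cube_le1 x' i) (cube_le1 x i) E.
  by split; [|left].
by split; [|right; rewrite -xx'].
Qed.

Local Notation ones := (\sum_(j < n) unit_vec j).

Lemma onesE i : ones 0 i = 1.
Proof.
rewrite summxE (bigD1 i)//= big1 ?addr0 => [|j ji]; rewrite mxE eqxx.
  by rewrite eqxx.
by rewrite eq_sym (negbTE ji).
Qed.

(** Adding [ones] flips every bit. This conjugates the entries from coordinates other than 0; at
    [x_1 = 1] the remaining entry is 1 or -1, and the flip negates it. *)
Lemma prism_map_ones (t : 'rV['F_2]_n) (x : @cube R n) : \val x 0 i0 = 1 ->
  prism_map (t + ones) x = klein_map (prism_map t x).
Proof.
move=> x1; apply/rowP => j; rewrite klein_mapE !mxE onesE.
move: (ordS j) => i; rewrite /prism_entry F2_addr1_neq0.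
case: eqP => [iE|_]; last first.
  by rewrite circle_conj_half_circle negbK.
rewrite (_ : i = i0) ?x1; last exact: val_inj.
rewrite /half divff ?pnatr_eq0// !mulr1 circle_opp_half_circle.
  by rewrite -signrN negbK.
by rewrite normr_sign.
Qed.

(** The entries from coordinate 0 lie on the upper half circle and are opposite, so they are 1 and
    -1; [half] has absolute value 1 only at 1. *)
Lemma prism_map_klein (t t' : 'rV['F_2]_n) (x x' : @cube R n) :
  prism_map t' x' = klein_map (prism_map t x) -> \val x 0 i0 = 1.
Proof.
move=> /rowP /(_ (ord_pred i0)).
rewrite klein_mapE !mxE ord_predK /prism_entry eqxx => /esym E.
have [+ _] := circle_opp_half_circle_false (half_le1 _ (cubeP x i0))
  (half_le1 _ (cubeP x' i0)) E.
have /andP[? ?] := cubeP x i0.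
rewrite normrMsign ger0_norm; lra.
Qed.

Lemma prism_map_half_onto (z : torus R n) :
  0 <= complex.Im (\val (z 0 (ord_pred i0))) ->
  exists t x, prism_map t x = z.
Proof.
move=> z0.
pose re i := complex.Re (\val (z 0 (ord_pred i))).
pose im i := complex.Im (\val (z 0 (ord_pred i))).
have re1 i : `|re i| <= 1 by exact: circle_Re_le1.
(* In coordinate 0 this inverts [half], whose sign bit will be the sign of [re i]. *)
pose v : 'rV[R]_n := \row_i if i == 0%N :> nat then 2 * `|re i| - 1 else re i.
have vP : v \in @cube R n.
  apply/mem_set => i; rewrite mxE; case: ifP => _; last by rewrite -ler_norml.
  by have := re1 i; have := normr_ge0 (re i); lra.
exists (\row_i (if i == 0%N :> nat then re i < 0 else im i < 0)%R%:R).
exists (exist (fun x => x \in @cube R n) v vP).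
apply/rowP => j; rewrite !mxE /prism_entry !F2_natb_neq0 [RHS]half_circleE.
have -> : z 0 j = z 0 (ord_pred (ordS j)) by rewrite ordSK.
rewrite -/(re _) -/(im _); move: (ordS j) => i.
case: (boolP (i == 0%N :> nat)) => [/eqP iE|//].
rewrite (_ : i = i0); last exact: val_inj.
rewrite [im _ < 0]ltNge z0 /= /half subrK mulrAC divff ?pnatr_eq0// mul1r.
by congr half_circle; rewrite mulr_sign; case: ltrP => ?;
  [rewrite ltr0_norm ?opprK|rewrite ger0_norm].
Qed.

(** One of [z] and [klein_map z] has its last entry in the closed upper half circle. *)
Lemma prism_map_onto (z : torus R n) :
  exists p : prism, prism_map p.1 p.2 = z \/ prism_map p.1 p.2 = klein_map z.
Proof.
have [/prism_map_half_onto[t [x <-]]|zlt0] :=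
  leP 0 (complex.Im (\val (z 0 (ord_pred i0)))).
  by exists (t, x); left.
have [|t [x tx]] := @prism_map_half_onto (klein_map z).
  rewrite klein_mapE ord_predK eqxx /=.
  by move: zlt0 => /=; case: (sval _) => a b /= ?; rewrite oppr_ge0 ltW.
by exists (t, x); right.
Qed.

Local Notation facets := (facet_group (@cube_facet R n) (@klein_chi n)).

Lemma folded_facet x i : folded x i -> unit_vec i \in facets (\val x).
Proof.
rewrite /folded => xi; apply: mem_gen; apply/imsetP.
have [iE|iE] := boolP (i == 0%N :> nat).
  rewrite iE in xi; exists (lshift n i).
    rewrite inE; apply/asboolP; split; first exact: set_valP.
    by rewrite split_lshift.
  by rewrite /klein_chi split_lshift.
rewrite (negbTE iE) in xi.
have /orP[/eqP x1|/eqP x1] : (\val x 0 i == 1) || (\val x 0 i == -1).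
    by have := eqr_norml (\val x 0 i) 1; rewrite xi eqxx ler01 andbT => <-.
  exists (rshift n i); last by rewrite /klein_chi split_rshift (negbTE iE).
  rewrite inE; apply/asboolP; split; first exact: set_valP.
  by rewrite split_rshift.
exists (lshift n i); last by rewrite /klein_chi split_lshift.
rewrite inE; apply/asboolP; split; first exact: set_valP.
by rewrite split_lshift.
Qed.

(** The difference is the sum of the unit vectors at the bits that differ, and each of these labels
    a facet through [x]. *)
Lemma folded_facet_group (x : @cube R n) (t t' : 'rV['F_2]_n) :
  (forall i, t' 0 i = t 0 i \/ folded x i) -> (t^-1 * t')%g \in facets (\val x).
Proof.
move=> tt'; rewrite [X in X \in _](_ : _ = t' - t); last exact: addrC.
rewrite [t' - t]row_sum_delta.
apply: (big_ind (fun v => v \in facets (\val x))) => [|u v uG vG|i _].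
- exact: group1.
- exact: groupM.
have [tE|/folded_facet xi] := tt' i.
  by rewrite !mxE tE subrr scale0r; exact: group1.
have [->|] := eqVneq ((t' - t) 0 i) 0; first by rewrite scale0r; exact: group1.
move=> d0; rewrite (_ : (t' - t) 0 i = 1) ?scale1r//.
by apply: F2_neq0_inj; rewrite d0 oner_eq0.
Qed.

Lemma prism_map_chi (x : @cube R n) (t : 'rV['F_2]_n) k :
  @cube_facet R n k (\val x) ->
  prism_map (t + klein_chi k) x = prism_map t x \/
  prism_map (t + klein_chi k) x = klein_map (prism_map t x).
Proof.
have fiber i : folded x i -> prism_map (t + unit_vec i) x = prism_map t x.
  move=> xi; apply: prism_map_fiber => j; rewrite !mxE eqxx.
  by have [->|_] := eqVneq j i; [right|left; rewrite addr0].
rewrite /cube_facet /klein_chi => -[_]; case: (fintype.split k) => i xi.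
  by left; apply: fiber; rewrite /folded xi normrN normr1; case: ifP.
case: eqP => iE.
  by right; apply: prism_map_ones; rewrite (_ : i0 = i)//; apply: val_inj.
by left; apply: fiber; rewrite /folded xi normr1; case: eqP.
Qed.

Lemma prism_map_facet_group (x : @cube R n) (t v : 'rV['F_2]_n) :
  v \in facets (\val x) ->
  prism_map (t + v) x = prism_map t x \/
  prism_map (t + v) x = klein_map (prism_map t x).
Proof.
(* It suffices that [H] is a subgroup containing the generators. Quantifying over all [t] makes [H]
   closed under the group law. *)
pose H := [set v : 'rV['F_2]_n | `[< forall t,
  prism_map (t + v) x = prism_map t x \/
  prism_map (t + v) x = klein_map (prism_map t x) >] ]%SET.
have gH : group_set H.
  apply/group_setP; split=> [|u w].
    by rewrite inE; apply/asboolP => s; left; rewrite addr0.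
  rewrite !inE => /asboolP uP /asboolP wP; apply/asboolP => s.
  rewrite [(u * w)%g](_ : _ = u + w)// addrA.
  by have [->|->] := wP (s + u); have [->|->] := uP s;
    rewrite ?klein_mapK; auto.
move=> vG; suff /fintype.subsetP/(_ v vG) : facets (\val x) \subset H.
  by rewrite inE => /asboolP.
rewrite (gen_subG _ (Group gH)).
apply/fintype.subsetP => _ /imsetP[k + ->]; rewrite !inE => xk.
by apply/asboolP => s; exact: prism_map_chi.
Qed.

Lemma klein_homeo_small_cover : homeomorphic (klein R n)
  (small_cover (@cube R n) (@cube_facet R n) (@klein_chi n)).
Proof.
apply: (@homeomorphic_involution_quotient _ _ _
  (fun p : prism => prism_map p.1 p.2)).
- exact: compact_prism.
- exact: hausdorff_torus.
- exact: continuous_prism_map.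
- exact: continuous_klein_map.
- exact: klein_mapK.
- exact: prism_map_onto.
- move=> [t x] [t' x'] [/= <-] /(prism_map_facet_group t).
  by rewrite [t + _](_ : _ = t')//; exact: mulKVg.
- move=> [t x] [t' x'] /= tt'; apply: rst_step => /=.
  have [E|E] := tt'.
    have [-> /folded_facet_group] := prism_map_inj E; by split.
  have x1 := prism_map_klein E.
  (* On the facet [x_1 = 1], [klein_map] amounts to adding [ones], the label of that facet, so
     [t + ones] is compared with [t']. *)
  have [-> tE] := prism_map_inj (etrans E (esym (prism_map_ones t x1))).
  split=> //; have := folded_facet_group tE.
  have onesG : ones \in facets (\val x).
    apply: mem_gen; apply/imsetP; exists (rshift n i0).
      rewrite inE; apply/asboolP; split; first exact: set_valP.
      by rewrite split_rshift.
    by rewrite /klein_chi split_rshift.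
  rewrite [X in X \in _ -> _](_ : _ = (ones^-1 * (t^-1 * t'))%g).
    by rewrite groupMl ?groupV.
  by rewrite mulgA -invMg.
Qed.

End SmallCoverKlein.

(** * The basis condition at the vertices of the cube *)

Lemma klein_chi_characteristic (R : realType) n :
  characteristic_function (@cube_facet R n) (@klein_chi n).
Proof.
have N1_neq1 : (-1 : R) <> 1 by lra.
move=> K v cardK vK.
have vF k : k \in K -> cube_facet k v.
  by have : [set v] v by []; rewrite -vK => /(_ k).
pose idx (k : 'I_(n + n)) :=
  match fintype.split k with inl i => i | inr i => i end.
(* Opposite facets are disjoint, so the [n] facets in [K] lie over distinct coordinates, hence over
   all of them. *)
have idx_inj : {in K &, injective idx}.
  move=> k k' /vF[_ kv] /vF[_ k'v]; rewrite /idx => kk'.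
  apply: (can_inj (@splitK n n)).
  case: (fintype.split k) (fintype.split k') kv k'v kk' =>
    [] i [] i' iv i'v ii';
    rewrite ii' //; case: N1_neq1.
    by rewrite -iv -i'v ii'.
  by rewrite -i'v -iv ii'.
have idx_onto i : exists2 k, k \in K & idx k = i.
  have : i \in idx @: K.
    suff -> : idx @: K = [set: 'I_n]%SET by rewrite inE.
    apply/eqP; rewrite eqEcard finset.subsetT cardsT card_ord.
    by rewrite (card_in_imset idx_inj) cardK /=.
  by move=> /imsetP[k kK ->]; exists k.
set X := [seq _ | j <- _].
have chiX k : k \in K -> klein_chi k \in <<X>>%VS.
  by move=> kK; apply/memv_span/map_f; rewrite mem_enum.
have eX1 (i : 'I_n) : i != 0%N :> nat -> unit_vec i \in <<X>>%VS.
  move=> i0; have [k kK ki] := idx_onto i.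
  by move: ki i0 (chiX k kK); rewrite /klein_chi /idx;
    case: (fintype.split k) => j -> // /negbTE ->.
have eX i : unit_vec i \in <<X>>%VS.
  have [i0|] := eqVneq (i : nat) 0%N; last exact: eX1.
  have [k kK ki] := idx_onto i; have := chiX k kK.
  move: ki; rewrite /klein_chi /idx; case: (fintype.split k) => j -> //.
  rewrite i0 eqxx (bigD1 i)//= => oX.
  (* The label is the sum of all unit vectors; removing the others, already in the span, leaves the
     one of index 0. *)
  rewrite -(addrK (\sum_(j < n | j != i) unit_vec j) (unit_vec i)).
  apply: rpredB => //; apply: memv_suml => l li; apply: eX1.
  by apply: contraNneq li => l0; apply/eqP/val_inj; rewrite /= l0 i0.
(* A spanning family of [n] vectors in dimension [n] is a basis. *)
rewrite basisEdim dimvf /dim /= mul1n size_map -cardE cardK leqnn andbT.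
apply/subvP => w _; rewrite (row_sum_delta w).
by apply: memv_suml => i _; apply: memvZ; exact: eX.
Qed.

Lemma bott_klein_matrix n : bott_matrix (klein_matrix n).
Proof.
exists 1%g, (klein_matrix n); split.
  move=> i j ji; rewrite mxE; case: eqP => //= i0.
  by rewrite i0 leqn0 in ji; rewrite (eqP ji).
by rewrite perm_mx1 invmx1 mul1mx mulmx1.
Qed.

Theorem theorem2p5 (R : realType) (n : nat) (hn : (0 < n)%N) :
  [/\ bott_matrix (klein_matrix n),
      homeomorphic (klein R n) (real_bott R (klein_matrix n)),
      characteristic_function (@cube_facet R n) (@klein_chi n)
    & homeomorphic (klein R n)
        (small_cover (@cube R n) (@cube_facet R n) (@klein_chi n))].
Proof.
split.
- exact: bott_klein_matrix.
- exact: klein_homeo_bott.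
- exact: klein_chi_characteristic.
- exact: klein_homeo_small_cover.
Qed.
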